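(* Let $G_f=(\mu_V,\mu_E)$ be a fuzzy graph on node set $V$ and let the edge $e=uv$ be contracted into $w$ using a $t$-norm $T$. For every $x\in V\setminus\{u,v\}$, \[ \mu'_E(wx)=T\big(\mu_E(ux),\mu_E(vx)\big)\;\le\;\min\{\mu_E(ux),\mu_E(vx)\}. \] Consequently, for any $\alpha\in(0,1]$, if $x$ is adjacent to $w$ in $(G_f/e)^{(\alpha)}$, then $x$ was adjacent to both $u$ and $v$ in $G_f^{(\alpha)}$.
   Context: A fuzzy graph is a pair $G_f=(\mu_V,\mu_E)$ with node membership $\mu_V:V\to[0,1]$ and edge membership $\mu_E(u,v)\in[0,1]$ (undirected edges), with $\mu_E(u,v)\le\min\{\mu_V(u),\mu_V(v)\}$. For $\alpha\in(0,1]$ its $\alpha$-cut is the crisp (ordinary) graph $G_f^{(\alpha)}$ with vertex set $\{v:\mu_V(v)\ge\alpha\}$ and edges $uv$ with $\mu_E(uv)\ge\alpha$. Fuzzy contraction: for an edge $e=uv$, $G_f/e$ has node set $(V\setminus\{u,v\})\cup\{w\}$, with $\mu(w)=\min\{\mu_V(u),\mu_V(v)\}$ (or an appropriate $t$-norm of these two values), and edge memberships $\mu'_E$ given by $\mu'_E(wx)=T(\mu_E(ux),\mu_E(vx))$ for every $x\in V\setminus\{u,v\}$, where $T:[0,1]^2\to[0,1]$ is a $t$-norm (commonly the minimum); all other memberships are unchanged. *)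

(* Defs.v *)
From HB Require Import structures.
From mathcomp Require Import all_boot all_order all_algebra.
From mathcomp Require Import interval_inference reals.

Set Implicit Arguments.
Unset Strict Implicit.
Unset Printing Implicit Defensive.

Import Order.TTheory GRing.Theory Num.Theory.
Local Open Scope ring_scope.

(* {i01 R} is the unit interval [0, 1] of R, with the order inherited from R. *)

Record tnorm (R : realType) := Tnorm {
  tnorm_op :> {i01 R} -> {i01 R} -> {i01 R};
  tnormC : commutative tnorm_op;
  tnormA : associative tnorm_op;
  tnorm_homo : forall a b c, b <= c -> tnorm_op a b <= tnorm_op a c;
  tnorm1 : forall a, tnorm_op a 1%:i01 = a }.

Section TnormTheory.
Variables (R : realType) (T : tnorm R).

Lemma tnorm_homo2 a b c d : a <= b -> c <= d -> T a c <= T b d.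
Proof.
move=> ab cd; apply: le_trans (tnorm_homo T a cd) _.
by rewrite (tnormC T a) (tnormC T b) tnorm_homo.
Qed.

Lemma tnorm_lel a b : T a b <= a.
Proof.
by rewrite -[leRHS](tnorm1 T) tnorm_homo // -num_le /= le1.
Qed.

End TnormTheory.

Section MinTnorm.
Variable R : realType.

Definition min01 (a b : {i01 R}) : {i01 R} := Num.min a b.

Lemma min01C : commutative min01. Proof. exact: minC. Qed.
Lemma min01A : associative min01. Proof. exact: minA. Qed.
Lemma min01_homo a b c : b <= c -> min01 a b <= min01 a c.
Proof. by move=> bc; apply: le_min2. Qed.
Lemma min01_1 a : min01 a 1%:i01 = a.
Proof. by apply/min_idPl; rewrite -num_le /= le1. Qed.

Definition min_tnorm : tnorm R := Tnorm min01C min01A min01_homo min01_1.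

Lemma tnorm_le_min (T : tnorm R) a b : T a b <= min_tnorm a b.
Proof. by rewrite /= /min01 le_min tnorm_lel tnormC tnorm_lel. Qed.

End MinTnorm.

(* Edges are unordered pairs of distinct nodes: mu_E is a symmetric function
   on pairs, and the diagonal, which carries no edge, has membership 0. *)
Record fuzzy_graph (R : realType) (V : eqType) := FuzzyGraph {
  mu_V : V -> {i01 R};
  mu_E : V -> V -> {i01 R};
  mu_E_sym : forall x y, mu_E x y = mu_E y x;
  mu_E_loop : forall x, mu_E x x = 0%:i01;
  mu_E_le : forall x y, mu_E x y <= Num.min (mu_V x) (mu_V y) }.

Definition is_edge (R : realType) (V : eqType) (G : fuzzy_graph R V) (u v : V) :=
  0%:i01 < mu_E G u v.

Record crisp_graph (V : eqType) := CrispGraph {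
  vertex : {pred V};
  adj : rel V;
  adj_sym : symmetric adj;
  adj_irr : irreflexive adj;
  adj_vertex : forall x y, adj x y -> (x \in vertex) && (y \in vertex) }.

Section Cut.
Variables (R : realType) (V : eqType) (G : fuzzy_graph R V).
Variables (alpha : {i01 R}) (alpha_gt0 : 0%:i01 < alpha).

Definition cut_vertex : {pred V} := [pred x | alpha <= mu_V G x].
Definition cut_adj : rel V := [rel x y | alpha <= mu_E G x y].

Lemma cut_adj_sym : symmetric cut_adj.
Proof. by move=> x y; rewrite /cut_adj /= mu_E_sym. Qed.

Lemma cut_adj_irr : irreflexive cut_adj.
Proof. by move=> x; rewrite /cut_adj /= mu_E_loop leNgt alpha_gt0. Qed.

Lemma cut_adj_vertex x y :
  cut_adj x y -> (x \in cut_vertex) && (y \in cut_vertex).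
Proof. by move=> /= /le_trans/(_ (mu_E_le G x y)); rewrite le_min !inE. Qed.

Definition cut : crisp_graph V :=
  CrispGraph cut_adj_sym cut_adj_irr cut_adj_vertex.

End Cut.

Section Contraction.
Variables (R : realType) (V : eqType) (G : fuzzy_graph R V).

Definition other_node (u v : V) := {x : V | (x != u) && (x != v)}.

(* (V \ {u, v}) together with one new node. *)
Definition contract_node (u v : V) := option (other_node u v).
Definition merged (u v : V) : contract_node u v := None.
Definition kept (u v : V) (x : other_node u v) : contract_node u v := Some x.

(* T merges the edge memberships and S the node memberships of u and v.  S is
   the minimum or another t-norm; S dominating T (true in particular for
   S = min and for S = T) is what makes the contraction a fuzzy graph again. *)
Variables (T S : tnorm R) (leTS : forall a b, T a b <= S a b) (u v : V).

Definition contract_mu_V (y : contract_node u v) : {i01 R} :=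
  match y with
  | None => S (mu_V G u) (mu_V G v)
  | Some x => mu_V G (val x)
  end.

Definition contract_mu_E (y z : contract_node u v) : {i01 R} :=
  match y, z with
  | None, None => 0%:i01
  | None, Some x | Some x, None => T (mu_E G u (val x)) (mu_E G v (val x))
  | Some x, Some x' => mu_E G (val x) (val x')
  end.

Lemma contract_mu_E_sym y z : contract_mu_E y z = contract_mu_E z y.
Proof. by case: y z => [x|] [x'|] //=; rewrite mu_E_sym. Qed.

Lemma contract_mu_E_loop y : contract_mu_E y y = 0%:i01.
Proof. by case: y => [x|] //=; rewrite mu_E_loop. Qed.

Lemma contract_mu_E_le y z :
  contract_mu_E y z <= Num.min (contract_mu_V y) (contract_mu_V z).
Proof.
have muE_le x x' : mu_E G x x' <= mu_V G x /\ mu_E G x x' <= mu_V G x'.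
  by apply/andP; rewrite -le_min mu_E_le.
have wx (x : other_node u v) : T (mu_E G u (val x)) (mu_E G v (val x)) <=
    Num.min (S (mu_V G u) (mu_V G v)) (mu_V G (val x)).
  have [leu lex] := muE_le u (val x); have [lev _] := muE_le v (val x).
  rewrite le_min (le_trans (leTS _ _)) ?tnorm_homo2 //=.
  exact: le_trans (tnorm_lel _ _ _) lex.
case: y z => [x|] [x'|] /=.
- exact: mu_E_le.
- by rewrite minC; apply: wx.
- exact: wx.
- by rewrite minxx -num_le /=.
Qed.

Definition contract : fuzzy_graph R (contract_node u v) :=
  FuzzyGraph contract_mu_E_sym contract_mu_E_loop contract_mu_E_le.

End Contraction.

(* Main.v *)
Require Import Defs.
From mathcomp Require Import all_boot all_order all_algebra.
From mathcomp Require Import interval_inference reals.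

Import Order.TTheory GRing.Theory Num.Theory.
Local Open Scope ring_scope.

(** A t-norm lies below the minimum: since [1] is neutral and [T] is monotone,
    [T a b <= T a 1 = a], and symmetrically [T a b <= b] ([tnorm_le_min]).  This
    bounds the membership of the merged edge by those of both original edges.
    A cut keeps the edges whose membership reaches the level [alpha], so
    [alpha <= T a b] forces [alpha <= a] and [alpha <= b]: an edge at the merged
    node survives the cut only if both edges that it merges survive it. *)

Theorem theorem3p3 (R : realType) (V : eqType) (G : fuzzy_graph R V)
    (T S : tnorm R) (leTS : forall a b : {i01 R}, T a b <= S a b)
    (u v : V) (e_uv : is_edge G u v) :
  (forall x : other_node u v,
     mu_E (contract G leTS u v) (merged u v) (kept x)
       = T (mu_E G u (val x)) (mu_E G v (val x)) /\
     T (mu_E G u (val x)) (mu_E G v (val x))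
       <= Num.min (mu_E G u (val x)) (mu_E G v (val x))) /\
  (forall (alpha : {i01 R}) (alpha_gt0 : 0%:i01 < alpha) (x : other_node u v),
     adj (cut (contract G leTS u v) alpha_gt0) (merged u v) (kept x) ->
     adj (cut G alpha_gt0) (val x) u /\ adj (cut G alpha_gt0) (val x) v).
Proof.
split=> [x | alpha alpha_gt0 x].
  by split; last exact: tnorm_le_min.
move=> /le_trans/(_ (tnorm_le_min T _ _)).
rewrite /= /min01 le_min => /andP[alpha_u alpha_v].
by rewrite !(cut_adj_sym G alpha (val x)).
Qed.
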